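(* Let $G=(V,E)$ be a connected locally finite graph and let $p\in[0,1)$. Assume that there are a constant $\kappa>0$ and a fixed vertex $x\in V$ such that $\kappa_p(x,y)\ge\kappa$ for all $y\in V\setminus\{x\}$. Then $G$ is finite.
   Context: Graphs have no multiple edges and no self loops. $d_v$ denotes the degree of the vertex $v$, $w\sim v$ means that $w$ and $v$ are adjacent, and $d(v,w)$ is the combinatorial distance (length of a shortest path). For $v\in V$ and $p\in[0,1]$, $\mu_v^p$ is the probability measure on $V$ with $\mu_v^p(v)=p$, $\mu_v^p(z)=\frac{1-p}{d_v}$ if $z\sim v$, and $\mu_v^p(z)=0$ otherwise. For probability measures $\mu_1,\mu_2$ on $V$, the Wasserstein distance is $W_1(\mu_1,\mu_2)=\inf_{\pi}\sum_{v\in V}\sum_{w\in V} d(v,w)\pi(v,w)$, the infimum over all $\pi:V\times V\to[0,1]$ with $\mu_1(v)=\sum_{w}\pi(v,w)$ and $\mu_2(w)=\sum_{v}\pi(v,w)$. For $x\ne y$ the $p$-Ollivier-Ricci curvature is $\kappa_p(x,y)=1-\frac{W_1(\mu_x^p,\mu_y^p)}{d(x,y)}$. *)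

(* Defs.v *)
From mathcomp Require Import all_boot all_order all_algebra finmap.
From mathcomp Require Import all_classical all_reals all_analysis.

Set Implicit Arguments.
Unset Strict Implicit.
Unset Printing Implicit Defensive.

Import Order.TTheory GRing.Theory Num.Theory.

Local Open Scope classical_set_scope.
Local Open Scope ring_scope.

(* A graph without multiple edges and self loops is a symmetric irreflexive
   relation [e : rel V] on its (possibly infinite) vertex type [V]. *)

Definition neighbors (V : choiceType) (e : rel V) (v : V) : set V :=
  [set w | e v w].

Definition locally_finite_graph (V : choiceType) (e : rel V) : Prop :=
  forall v : V, finite_set (neighbors e v).

Definition connected_graph (V : choiceType) (e : rel V) : Prop :=
  forall v w : V, exists s : seq V, path e v s /\ last v s = w.

(* Junk value [0] if [v] has infinitely many neighbors. *)
Definition degree (V : choiceType) (e : rel V) (v : V) : nat :=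
  #|` fset_set (neighbors e v)|%fset.

Definition path_of_length (V : choiceType) (e : rel V) (v w : V) (n : nat) :
    Prop :=
  exists s : seq V, [/\ path e v s, last v s = w & size s = n].

(* Junk value [0] if no path joins [v] to [w]. *)
Definition graph_dist (V : choiceType) (e : rel V) (v w : V) : nat :=
  if pselect (exists n, `[< path_of_length e v w n >]) is left ex_n
  then ex_minn ex_n else 0%N.

(* Measures on the vertex set are given by their point masses. *)
Definition lazy_walk_measure (R : realType) (V : choiceType) (e : rel V)
    (p : R) (v : V) : V -> R :=
  fun z => if z == v then p
           else if e v z then (1 - p) / (degree e v)%:R else 0.

Definition transport_plan (R : realType) (V : choiceType)
    (mu1 mu2 : V -> R) (pi : V -> V -> R) : Prop :=
  [/\ forall v w : V, 0 <= pi v w <= 1,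
      forall v : V, (mu1 v)%:E = (\esum_(w in [set: V]) (pi v w)%:E)%E
    & forall w : V, (mu2 w)%:E = (\esum_(v in [set: V]) (pi v w)%:E)%E].

Definition transport_cost (R : realType) (V : choiceType) (e : rel V)
    (pi : V -> V -> R) : \bar R :=
  (\esum_(v in [set: V]) \esum_(w in [set: V])
     ((graph_dist e v w)%:R * pi v w)%:E)%E.

Definition wasserstein1 (R : realType) (V : choiceType) (e : rel V)
    (mu1 mu2 : V -> R) : \bar R :=
  ereal_inf [set transport_cost e pi | pi in transport_plan mu1 mu2].

(* Kept in [\bar R], so that no finiteness of the Wasserstein distance is
   presupposed. *)
Definition ollivier_ricci (R : realType) (V : choiceType) (e : rel V)
    (p : R) (x y : V) : \bar R :=
  (1 - wasserstein1 e (lazy_walk_measure e p x) (lazy_walk_measure e p y)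
       * ((graph_dist e x y)%:R^-1)%:E)%E.

(* Main.v *)
Require Import Defs.
From mathcomp Require Import all_boot all_order all_algebra.
From mathcomp Require Import all_classical all_reals all_analysis.
From mathcomp Require Import finmap zify.

Import Order.TTheory GRing.Theory Num.Theory.

Local Open Scope classical_set_scope.
Local Open Scope ring_scope.

(** A transport plan from [mu_x] to [mu_y] only moves mass from the unit ball
    around [x] to the unit ball around [y], hence over a distance at least
    [d(x,y) - 2]; so [W_1(mu_x, mu_y) >= d(x,y) - 2], and the curvature bound
    gives [kappa * d(x,y) <= 2].  All vertices therefore lie in a ball around
    [x], and balls are finite by local finiteness. *)

Lemma graph_dist_le (V : choiceType) (e : rel V) (v w : V) (n : nat) :
  path_of_length e v w n -> (graph_dist e v w <= n)%N.
Proof.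
move=> vw; rewrite /graph_dist; case: pselect => // ex_n.
by case: ex_minnP => m _; apply; apply/asboolP.
Qed.

(** Connectedness rules out the junk value [0], so the minimum is attained by an actual path. *)
Lemma graph_dist_path {V : choiceType} {e : rel V} (v w : V) :
  connected_graph e -> path_of_length e v w (graph_dist e v w).
Proof.
move=> e_conn; rewrite /graph_dist; case: pselect => [ex_n|[]].
  by case: ex_minnP => m /asboolP.
by have [s [vs sw]] := e_conn v w; exists (size s); apply/asboolP; exists s.
Qed.

Lemma path_of_length_cat (V : choiceType) (e : rel V) (u v w : V) (m n : nat) :
  path_of_length e u v m -> path_of_length e v w n ->
  path_of_length e u w (m + n).
Proof.
move=> [s [us sv <-]] [t [vt tw <-]]; exists (s ++ t).
by rewrite cat_path last_cat size_cat us sv.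
Qed.

Lemma graph_dist_triangle {V : choiceType} {e : rel V} (v u w : V) :
  connected_graph e ->
  (graph_dist e u w <= graph_dist e u v + graph_dist e v w)%N.
Proof.
move=> e_conn; apply: graph_dist_le.
exact: path_of_length_cat (graph_dist_path _ _ e_conn)
                          (graph_dist_path _ _ e_conn).
Qed.

Lemma graph_dist_gt0 (V : choiceType) (e : rel V) (v w : V) :
  connected_graph e -> v != w -> (0 < graph_dist e v w)%N.
Proof.
move=> e_conn; apply: contraR; rewrite -eqn0Ngt => /eqP d0.
by have := graph_dist_path v w e_conn; rewrite d0 => -[[|u s] [_ //= ->]].
Qed.

(** Induction on the length, splitting off the first edge: a finite union, over the neighbors of
    [v], of finite sets. *)
Lemma finite_path_of_length (V : choiceType) (e : rel V) (v : V) (n : nat) :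
  locally_finite_graph e -> finite_set [set w | path_of_length e v w n].
Proof.
move=> e_lf; elim: n v => [|n IHn] v.
  by apply: (sub_finite_set (B := [set v])) => // w /= [[|u s] [_ //= ->]].
apply: (@sub_finite_set _ _
    (\bigcup_(u in neighbors e v) [set w | path_of_length e u w n])); last first.
  exact: bigcup_finite.
move=> w /= [[|u s] [//= /andP[vu us] sw [sn]]].
by exists u => //; exists s.
Qed.

Lemma graph_dist_le1 (V : choiceType) (e : rel V) (v w : V) :
  v = w \/ e v w -> (graph_dist e v w <= 1)%N.
Proof.
move=> [<-|vw].
  by apply: leq_trans (leq0n 1); apply: graph_dist_le; exists [::].
by apply: graph_dist_le; exists [:: w]; rewrite /= vw.
Qed.

Lemma lazy_walk_measure_support (R : realType) (V : choiceType) (e : rel V)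
    (p : R) (v z : V) :
  lazy_walk_measure e p v z != 0 -> v = z \/ e v z.
Proof.
rewrite /lazy_walk_measure; case: (eqVneq z v) => [->|_]; first by left.
by case: ifPn => [|_]; [right|rewrite eqxx].
Qed.

(** The finite partial sum over the closed unit ball is already [p + (1 - p)]. A neighbor is
    required: an isolated vertex would carry mass [p] only. *)
Lemma lazy_walk_measure_mass (R : realType) (V : choiceType) (e : rel V) (p : R)
    (v : V) :
  irreflexive e -> finite_set (neighbors e v) -> neighbors e v !=set0 ->
  (1 <= \esum_(z in [set: V]) (lazy_walk_measure e p v z)%:E)%E.
Proof.
move=> e_irr fin_v [u vu]; apply: esum_ge; exists (v |` neighbors e v).
  by split => //; rewrite finite_setU; split.
have deg_gt0 : (0 < degree e v)%N.
  rewrite /degree cardfs_gt0; apply/fset0Pn; exists u.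
  by rewrite in_fset_set// mem_set.
(* Without self loops, the center is not counted again among its neighbors. *)
rewrite fsbigU0//; last by move=> w /= [-> ]; rewrite /neighbors/= e_irr.
rewrite fsbig_set1 (eq_fsbigr (fun=> ((1 - p) / (degree e v)%:R)%:E)); last first.
  move=> z /set_mem; rewrite /lazy_walk_measure /neighbors /= => vz.
  by rewrite vz; case: (eqVneq z v) vz => // ->; rewrite e_irr.
rewrite fsbig_finite// sumEFin big_const_seq count_predT -Monoid.iteropE /=.
rewrite /lazy_walk_measure eqxx -EFinD lee_fin -[iterop _ _ _ _]/(_ *+ _).
by rewrite -[_ / _ *+ _]mulr_natr divfK ?pnatr_eq0 -?lt0n// subrKC.
Qed.

(** Serves to pull a uniform lower bound on distances out of the double sum defining the transport
    cost. *)
Lemma esumMn (R : realType) (T : choiceType) (I : set T) (a : T -> \bar R)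
    (n : nat) : (forall i, I i -> 0 <= a i)%E ->
  (\esum_(i in I) (n%:R%:E * a i) = n%:R%:E * \esum_(i in I) a i)%E.
Proof.
move=> a_ge0; elim: n => [|n IHn].
  by rewrite mul0e; apply: esum1 => i _; rewrite mul0e.
have mulSe (y : \bar R) : (0 <= y)%E -> (n.+1%:R%:E * y = y + n%:R%:E * y)%E.
  by move=> y_ge0; rewrite -natr1 addrC EFinD ge0_muleDl ?lee_fin// mul1e.
rewrite mulSe ?esum_ge0// -IHn -esumD//; last first.
  by move=> i Ii; rewrite mule_ge0 ?lee_fin ?a_ge0.
by apply: eq_esum => i Ii; rewrite mulSe ?a_ge0.
Qed.

(** Entries are nonnegative, so each one is bounded by its row sum and by its column sum, which are
    the two marginals. *)
Lemma transport_plan_support (R : realType) (V : choiceType)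
    (mu1 mu2 : V -> R) (pi : V -> V -> R) (v w : V) :
  transport_plan mu1 mu2 pi -> pi v w != 0 -> mu1 v != 0 /\ mu2 w != 0.
Proof.
move=> [pi01 pi1 pi2] pi_neq0.
have pi_ge0 a b : (0 <= (pi a b)%:E)%E by rewrite lee_fin; case/andP: (pi01 a b).
have pi_gt0 : 0 < pi v w by rewrite lt_def pi_neq0 -lee_fin pi_ge0.
split; apply: lt0r_neq0; apply: (lt_le_trans pi_gt0); rewrite -lee_fin.
  rewrite pi1; apply: esum_ge; exists [set w]; first by split.
  by rewrite fsbig_set1.
rewrite pi2; apply: esum_ge; exists [set v]; first by split.
by rewrite fsbig_set1.
Qed.

(** Every pair charged by [pi] is at distance at least [n], and the total mass of [pi] is that of
    its first marginal [mu1]. *)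
Lemma transport_cost_ge (R : realType) (V : choiceType) (e : rel V)
    (mu1 mu2 : V -> R) (pi : V -> V -> R) (n : nat) :
  transport_plan mu1 mu2 pi ->
  (forall v w, mu1 v != 0 -> mu2 w != 0 -> (n <= graph_dist e v w)%N) ->
  (n%:R%:E * (\esum_(v in [set: V]) (mu1 v)%:E) <= transport_cost e pi)%E.
Proof.
move=> plan far; have [pi01 pi1 _] := plan.
have pi_ge0 v w : 0 <= pi v w by case/andP: (pi01 v w).
have mu_ge0 v : (0 <= (mu1 v)%:E)%E.
  by rewrite pi1; apply: esum_ge0 => w _; rewrite lee_fin.
rewrite -esumMn//; apply: le_esum => v _; rewrite pi1 -esumMn; last first.
  by move=> w _; rewrite lee_fin.
apply: le_esum => w _; rewrite -EFinM lee_fin.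
have [->|pi_neq0] := eqVneq (pi v w) 0; first by rewrite !mulr0.
have [mu1_neq0 mu2_neq0] := transport_plan_support _ _ _ _ _ _ _ plan pi_neq0.
by rewrite ler_wpM2r// ler_nat far.
Qed.

Lemma wasserstein1_lazy_walk_ge (R : realType) (V : choiceType) (e : rel V)
    (p : R) (x y : V) :
  symmetric e -> irreflexive e -> connected_graph e -> locally_finite_graph e ->
  x != y ->
  ((graph_dist e x y - 2)%:R%:E <=
   wasserstein1 e (lazy_walk_measure e p x) (lazy_walk_measure e p y))%E.
Proof.
move=> e_sym e_irr e_conn e_lf xy.
apply: le_ereal_inf_tmp => _ [pi plan <-].
(* The first edge of a path from [x] to [y] exists since [x != y]; hence [x] is not isolated and its
   measure has full mass. *)
have nbr_x : neighbors e x !=set0.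
  have [[|z s] [/= xs sy]] := e_conn x y; first by rewrite sy eqxx in xy.
  by case/andP: xs => xz _; exists z.
apply: le_trans; last first.
  apply: (transport_cost_ge _ _ _ _ _ _ (graph_dist e x y - 2) plan) => v w.
  move=> /lazy_walk_measure_support/graph_dist_le1 xv.
  move=> /lazy_walk_measure_support wy.
  have {}wy : (graph_dist e w y <= 1)%N.
    by apply: graph_dist_le1; rewrite e_sym; case: wy => [->|]; [left|right].
  (* Here d(x,y) <= d(x,v) + d(v,w) + d(w,y), whose outer terms are at most 1. The truncated
     subtraction makes the bound trivial when d(x,y) < 2. *)
  have := graph_dist_triangle v x y e_conn.
  have := graph_dist_triangle w v y e_conn.
  by lia.
rewrite -[leLHS]mule1 lee_wpmul2l ?lee_fin//.
exact: lazy_walk_measure_mass.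
Qed.

Lemma curvature_dist_le (R : realType) (V : choiceType) (e : rel V)
    (p kappa : R) (x y : V) :
  symmetric e -> irreflexive e -> connected_graph e -> locally_finite_graph e ->
  x != y -> (kappa%:E <= ollivier_ricci e p x y)%E ->
  kappa * (graph_dist e x y)%:R <= 2.
Proof.
move=> e_sym e_irr e_conn e_lf xy.
have W_ge := wasserstein1_lazy_walk_ge R V e p x y e_sym e_irr e_conn e_lf xy.
have d_gt0 : 0 < (graph_dist e x y)%:R :> R by rewrite ltr0n graph_dist_gt0.
rewrite /ollivier_ricci => /le_trans; set d := graph_dist e x y in W_ge d_gt0 *.
move=> /(_ (1 - (d - 2)%:R%:E * (d%:R^-1)%:E)%E) curv_le.
have {}curv_le : kappa <= 1 - (d - 2)%:R / d%:R.
  rewrite -lee_fin; apply: curv_le.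
  by rewrite leeB// lee_wpmul2r.
(* After clearing the denominator, what remains is [d <= 2 + (d - 2)], true for truncated
   subtraction as well. *)
rewrite -ler_pdivlMr// (le_trans curv_le)// lerBlDr -mulrDl ler_pdivlMr//.
by rewrite mul1r -natrD ler_nat; lia.
Qed.

Theorem theorem7p5 (R : realType) (V : choiceType) (e : rel V)
    (e_sym : symmetric e) (e_irr : irreflexive e)
    (e_conn : connected_graph e) (e_lf : locally_finite_graph e)
    (p : R) (p_ge0 : 0 <= p) (p_lt1 : p < 1)
    (kappa : R) (kappa_gt0 : 0 < kappa) (x : V)
    (curv : forall y : V, y != x -> (kappa%:E <= ollivier_ricci e p x y)%E) :
  finite_set [set: V].
Proof.
have bound_ge0 : 0 <= 2 / kappa by rewrite divr_ge0// ltW.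
(* [Num.bound] gives a natural number above the radius [2 / kappa]; the successor is there because
   [I_] is a strict initial segment. *)
apply: (@sub_finite_set _ _ (\bigcup_(n in `I_(Num.bound (2 / kappa)).+1)
    [set y | path_of_length e x y n])); last first.
  by apply: bigcup_finite => // n _; apply: finite_path_of_length.
move=> y _; exists (graph_dist e x y); last exact: graph_dist_path.
(* The curvature hypothesis says nothing about [x] itself, which is at distance 0. *)
rewrite /= ltnS; have [->|yx] := eqVneq y x.
  by apply: leq_trans (leq0n _); apply: graph_dist_le; exists [::].
rewrite -(ler_nat R); apply: le_trans (ltW (archi_boundP bound_ge0)).
rewrite ler_pdivlMr// mulrC; apply: curvature_dist_le (curv _ yx) => //.
by rewrite eq_sym.
Qed.
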